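(* Let $\mathcal{G}$ be a multiplex network with agent set $V=\{1,\dots,n\}$ and let $\mathcal{U}=(u_1,\dots,u_n)\in\{\mathrm{OR},\mathrm{AND}\}^n$ be a sequence of protocols. Then for a seed set $S_0\subseteq V$ and for an agent $j\in V$, the multiplex influence spread of the agents in $S_0$ and the multiplex cascade centrality of agent $j$ are $$\sigma^{\mathcal{U}}_{S_0}=\sum_{i=1}^n r^{\mathcal{U}}_{iS_0},\qquad \mathcal{C}^{\mathcal{U}}_j=\sum_{i=1}^n r^{\mathcal{U}}_{ij},$$ where $r^{\mathcal U}_{ij}$ denotes $r^{\mathcal U}_{iS_0}$ for $S_0=\{j\}$.
   Context: Multiplex network: a family of $m\ge 1$ directed weighted graphs (layers) $G_k=(V,E^k)$, $k=1,\dots,m$, on a common agent set $V=\{1,\dots,n\}$. An edge $e^k_{i,j}\in E^k$ points from $i$ to $j$ (agent $i$ senses agent $j$ in layer $k$) and has weight $w^k_{i,j}>0$. $N_i^k=\{j: e^k_{i,j}\in E^k\}$ is the set of out-neighbors of $i$ in layer $k$, and $\sum_{j\in N_i^k}w^k_{i,j}=1$. It is assumed that each $i\notin S_0$ has at least one out-neighbor in each layer. Multiplex LTM: thresholds $\mu_i^k$ ($i\in V$, $k=1,\dots,m$) are drawn independently from the uniform distribution on $(0,1)$. $x_i(t)\in\{0,1\}$ is the state of agent $i$ at iteration $t$, and $S_t=\{i:x_i(t)=1\}$; initially $x_i(0)=1$ iff $i\in S_0$ (the seeds). For $t\ge1$ let $y_i^k(t)=1$ if $\mu_i^k<\sum_{j\in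 N_i^k\cap S_{t-1}}w^k_{i,j}$ and $y_i^k(t)=0$ otherwise. Then $x_i(t)=1$ if $x_i(t-1)=1$, or if $u_i=\mathrm{OR}$ and $y_i^k(t)=1$ for at least one $k$, or if $u_i=\mathrm{AND}$ and $y_i^k(t)=1$ for all $k$; otherwise $x_i(t)=0$. $\bar x_i=\lim_{t\to\infty}x_i(t)$. The multiplex influence spread is the expected number of agents active at steady state, $\sigma^{\mathcal{U}}_{S_0}=\mathbb{E}\big(\sum_{i=1}^n\bar x_i\big)=\sum_{i=1}^n\mathbb{P}^{\mathcal{G},\mathcal{U}}_{S_0}(\bar x_i=1)$, and the multiplex cascade centrality of $j$ is $\mathcal{C}_j^{\mathcal U}=\sigma^{\mathcal U}_{\{j\}}$. Multiplex live-edge model (LEM): in each layer $k$, each agent $i\notin S_0$ randomly (independently over agents and layers) selects exactly one of its outgoing edges, selecting $e^k_{i,j}$ with probability $w^k_{i,j}$; selected edges are ''live'' and all others ''blocked''. Seeds block all their outgoing edges. The choice of live edges is a multiplex selection of live edges; $L$ is the set of all of them, and $q_l$, the probability of $l\in L$, is the product of the weights of all live edges in $l$. Live-edge tree: given $l\in L$ and $i\notin S_0$, $T^l_i$ has root node $i$; if $e^k_{i,j_k}$ is the live edge of $i$ in layer $k$, the children of the root are $j_1,\dots,j_m$, each connected to the root by the corresponding live edge; the tree is continued recursively in the same way from each child that itself has live edges. An agent may appear several times as a node in the tree. $\mathcal{U}$-reachability: $\mathcal{B}^l_i$ is the set of distinct branches of $T^l_i$ that end in a seed, i.e. of the form $B=(i,e^{k_0}_{i,i_1},i_1,e^{k_1}_{i_1,i_2},i_2,\dots,i_s)$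 with $i_s\in S_0$ and each agent of $V$ appearing at most once in $B$. For $\hat{\mathcal B}\subseteq\mathcal{B}^l_i$ let $\hat V$ be the set of agents in $\hat{\mathcal B}$ and $\hat E$ the set of edges in $\hat{\mathcal B}$. $\hat{\mathcal B}$ is $\mathcal{U}$-feasible for $i$ if $\hat{\mathcal B}\ne\varnothing$ and for every $\hat i\in\hat V\setminus S_0$ with $u_{\hat i}=\mathrm{AND}$, all of $\hat i$'s live edges belong to $\hat E$. Agent $i\notin S_0$ is $\mathcal{U}$-reachable from $S_0$ by selection $l$ if some $\hat{\mathcal B}\subseteq\mathcal{B}^l_i$ is $\mathcal{U}$-feasible for $i$. $L^{\mathcal U}_{iS_0}$ is the set of all $l\in L$ by which $i$ is $\mathcal{U}$-reachable from $S_0$, and $r^{\mathcal U}_{iS_0}=\sum_{l\in L^{\mathcal U}_{iS_0}}q_l$. For $i\in S_0$, $r^{\mathcal U}_{iS_0}=1$ by convention.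
   Formalization: Feasibility is read on the live-edge tree: each occurrence of an AND agent must have all its live edges, at that occurrence, on the chosen branches. With V̂ and Ê as plain sets of agents and edges the claim fails, as two AND agents sensing each other can support one another circularly. *)

(* Defs.v *)
From HB Require Import structures.
From mathcomp Require Import all_boot all_order all_algebra.
From mathcomp Require Import all_classical all_reals all_analysis.

Set Implicit Arguments.
Unset Strict Implicit.
Unset Printing Implicit Defensive.

Import Order.TTheory GRing.Theory Num.Theory.
Import numFieldTopology.Exports.

Local Open Scope ring_scope.

(* Agents are 'I_n, layers are 'I_m.  [edge k i j] means that i senses j in
   layer k; [weight k i j] is only meaningful when [edge k i j] holds.  The
   weights are normalized at the agents that have out-neighbors, because seeds
   need not have any. *)
Record multiplex (R : realType) (n m : nat) := Multiplex {
  edge : 'I_m -> rel 'I_n ;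
  weight : 'I_m -> 'I_n -> 'I_n -> R ;
  weight_gt0 : forall k i j, edge k i j -> 0 < weight k i j ;
  weight_sum1 : forall k i, (exists j, edge k i j) ->
    \sum_(j | edge k i j) weight k i j = 1 }.

Inductive protocol := OR | AND.

Section Network.
Context {R : realType} {n m : nat}.
Variables (G : multiplex R n m) (U : 'I_n -> protocol) (S0 : {set 'I_n}).

Definition out_neighbors (k : 'I_m) (i : 'I_n) : {set 'I_n} :=
  [set j | edge G k i j]%SET.

Definition nonseeds_have_out_neighbors : Prop :=
  forall i k, i \notin S0 -> exists j, j \in out_neighbors k i.

Definition layer_input (mu : 'I_n -> 'I_m -> R) (S : {set 'I_n})
    (i : 'I_n) (k : 'I_m) : bool :=
  mu i k < \sum_(j in (out_neighbors k i :&: S)%SET) weight G k i j.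

Fixpoint ltm_state (mu : 'I_n -> 'I_m -> R) (t : nat) (i : 'I_n) : bool :=
  if t is t'.+1 then
    let S := [set j | ltm_state mu t' j]%SET in
    ltm_state mu t' i ||
    match U i with
    | OR => [exists k, layer_input mu S i k]
    | AND => [forall k, layer_input mu S i k]
    end
  else i \in S0.

Definition ltm_steady (mu : 'I_n -> 'I_m -> R) (i : 'I_n) : R :=
  limn (fun t : nat => (ltm_state mu t i)%:R : R).

(* [l (i, k) = Some j] means that the live edge of i in layer k points to j,
   [None] that i has no live edge in layer k. *)
Definition selection := {ffun 'I_n * 'I_m -> option 'I_n}.

Definition live_selections : {set selection} :=
  [set l : selection | [forall i, forall k,
     if i \in S0 then l (i, k) == None
     else if l (i, k) is Some j then edge G k i j else false]]%SET.

Definition selection_prob (l : selection) : R :=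
  \prod_(ik : 'I_n * 'I_m)
    (if l ik is Some j then weight G ik.2 ik.1 j else 1).

(* A node of the live-edge tree of i, which may be infinite, is represented by
   the path leading to it from the root: the sequence of the steps
   (layer, agent) along this path. *)
Definition node := seq ('I_m * 'I_n).

Definition node_agent (i : 'I_n) (p : node) : 'I_n := last i (map snd p).

Fixpoint in_tree (l : selection) (i : 'I_n) (p : node) : bool :=
  if p is (k, j) :: p' then (l (i, k) == Some j) && in_tree l j p' else true.

(* A branch is represented by its end node. *)
Definition branches (l : selection) (i : 'I_n) : set node :=
  [set B : node | [/\ in_tree l i B, node_agent i B \in S0
                    & uniq (i :: map snd B)]]%classic.

(* The agents and the edges of a set of branches of the live-edge tree are
   those of the tree: an agent (or an edge) appearing several times in the tree
   counts once for each appearance.  An occurrence of an agent is a node; an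
   occurrence of an edge is the pair of the node it starts from and the step it
   makes.  Identifying the occurrences of an agent would allow circular
   reachability, in which two AND agents sensing each other each use an edge
   that belongs to a branch through the other one. *)
Definition nodes_of (Bs : set node) : set node :=
  [set p : node | exists2 B, Bs B & prefix p B]%classic.

Definition edges_of (Bs : set node) : set (node * ('I_m * 'I_n)) :=
  [set e : node * ('I_m * 'I_n) |
     exists2 B, Bs B & prefix (rcons e.1 e.2) B]%classic.

Definition feasible (l : selection) (i : 'I_n) (Bs : set node) : Prop :=
  (Bs !=set0)%classic /\
  forall p, nodes_of Bs p ->
    node_agent i p \notin S0 -> U (node_agent i p) = AND ->
    forall k j, l (node_agent i p, k) = Some j -> edges_of Bs (p, (k, j)).

Definition reachable (l : selection) (i : 'I_n) : Prop :=
  exists Bs : set node, (Bs `<=` branches l i)%classic /\ feasible l i Bs.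

Definition reach_prob (i : 'I_n) : R :=
  if i \in S0 then 1
  else \sum_(l in live_selections | `[< reachable l i >]) selection_prob l.

End Network.

Arguments selection : clear implicits.
Arguments node : clear implicits.

Definition mutually_independent d (T : measurableType d) (R : realType)
    (P : probability T R) (I : finType) (X : I -> {RV P >-> R}) : Prop :=
  forall (J : {set I}) (A : I -> set R), (forall i, measurable (A i)) ->
    P (\bigcap_(i in [set i | i \in J]) (X i @^-1` A i))%classic =
    (\prod_(i in J) P (X i @^-1` A i)%classic)%E.

(* The library's uniform distribution on [0, 1] is the one on (0, 1). *)
Definition iid_uniform d (T : measurableType d) (R : realType)
    (P : probability T R) (n m : nat)
    (mu : 'I_n -> 'I_m -> {RV P >-> R}) : Prop :=
  (forall i k (A : set R), measurable A ->
     distribution P (mu i k) A = uniform_prob (@ltr01 R) A) /\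
  mutually_independent (fun ik : 'I_n * 'I_m => mu ik.1 ik.2).

Definition influence_spread d (T : measurableType d) (R : realType)
    (P : probability T R) (n m : nat) (mu : 'I_n -> 'I_m -> {RV P >-> R})
    (G : multiplex R n m) (U : 'I_n -> protocol) (S0 : {set 'I_n}) : \bar R :=
  'E_P[fun w => (\sum_(i < n) ltm_steady G U S0 (fun i k => mu i k w) i)%R]%E.

Definition cascade_centrality d (T : measurableType d) (R : realType)
    (P : probability T R) (n m : nat) (mu : 'I_n -> 'I_m -> {RV P >-> R})
    (G : multiplex R n m) (U : 'I_n -> protocol) (j : 'I_n) : \bar R :=
  influence_spread mu G U [set j]%SET.

(* Main.v *)
(* Both models are instances of one cascade: every (agent, layer) pair carries an
   independent random response, a monotone predicate telling which active sets
   trigger it.  A cascade sees the responses only along the increasing chain of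
   active sets it produces, and along a fixed chain the vector of responses of a
   pair is determined by the first set that triggers it.  By summation by parts
   the law of that first time depends only on the probabilities that the single
   sets of the chain trigger the pair.  These agree for the two models: a uniform
   threshold lies below the weight of X with the same probability as the live
   edge points into X.  Deterministically, an agent is in the final set of the
   live-edge cascade iff it is U-reachable: branches that follow decreasing
   activation times are a feasible set, and conversely activation propagates from
   the ends of a feasible set of branches back to its root. *)
Require Import Defs.
From mathcomp Require Import all_boot all_order all_algebra.
From mathcomp Require Import all_classical all_reals all_analysis.
Import Order.TTheory GRing.Theory Num.Theory numFieldTopology.Exports.
Local Open Scope ring_scope.
Set Implicit Arguments.
Unset Strict Implicit.

(** * Monotone responses along a chain and the law of a cascade *)

Lemma find_leq_nth (V : finType) (y : {set V} -> bool) (A : seq {set V}) (s : nat) :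
  {homo y : X Y / X \subset Y >-> X ==> Y} ->
  sorted (fun X Y : {set V} => X \subset Y) A -> (s < size A)%N ->
  (find y A <= s)%N = y (nth finset.set0 A s).
Proof.
move=> y_mono A_sorted sA; apply/idP/idP => [le_fs|]; last first.
  by move=> ys; rewrite leqNgt; apply/negP => /(before_find finset.set0);
     rewrite ys.
have hasA : has y A by rewrite has_find (leq_ltn_trans le_fs).
have /implyP := y_mono _ _ (sorted_leq_nth
  (fun _ _ _ => @fintype.subset_trans V _ _ _) (fun X : {set V} => fintype.subxx X)
  finset.set0 A_sorted _ _ (leq_ltn_trans le_fs sA) sA le_fs).
by apply; apply: nth_find.
Qed.

(** Telescoping turns any function of a first time [t] into a combination of the indicators
    [t <= s], the events whose masses are known. *)
Lemma sum_by_parts (R : pzRingType) (h : nat -> R) (t M : nat) : (t <= M)%N ->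
  h t = h M + \sum_(0 <= s < M) (t <= s)%:R * (h s - h s.+1).
Proof.
move=> tM; rewrite (big_cat_nat (n := t)) //= big_nat_cond big1 => [|s]; last first.
  by rewrite andbT => /andP[_ st]; rewrite leqNgt st mul0r.
rewrite add0r (eq_big_nat _ _ (F2 := fun s => - (h s.+1 - h s))) => [|s /andP[ts _]].
  by rewrite sumrN telescope_sumr // opprB addrC subrK.
by rewrite ts mul1r opprB.
Qed.

Section Law.
Variables (R : comPzRingType) (I V : finType) (N : nat).
Variable c : (I -> bool) -> {set V} -> {set V}.
Hypothesis sub_c : forall b (X : {set V}), X \subset c b X.

(** The start is the empty set, so the seeds have to be supplied by [c] at the first step. *)
Definition run (z : {set V} -> I -> bool) (t : nat) : {set V} :=
  iter t (fun X => c (z X) X) finset.set0.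

(* [f i] stands for the index of the first set of [A] that triggers [i]; it is
   [N.+1] when no set does. *)
Definition is_run (A : N.+1.-tuple {set V}) (f : I -> nat) : bool :=
  (nth finset.set0 A 0 == finset.set0) &&
  [forall s : 'I_N, nth finset.set0 A s.+1 ==
     c (fun i => f i <= s)%N (nth finset.set0 A s)].

Variables (Omega : finType) (p : I -> Omega -> R).
Variable y : I -> Omega -> {set V} -> bool.
Hypothesis y_mono : forall i x, {homo y i x : X Y / X \subset Y >-> X ==> Y}.

Definition run_tuple (z : {set V} -> I -> bool) : N.+1.-tuple {set V} :=
  Tuple (introT eqP (size_traject (fun X => c (z X) X) finset.set0 N.+1)).

Lemma nth_run_tuple z s : (s <= N)%N -> nth finset.set0 (run_tuple z) s = run z s.
Proof. by move=> sN; rewrite nth_traject. Qed.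

Lemma run_tuple_sorted z :
  sorted (fun X Y : {set V} => X \subset Y) (run_tuple z).
Proof.
apply: (@sub_sorted _ (frel (fun X => c (z X) X))) => [X Y /= /eqP <-|] //.
exact: fpath_traject.
Qed.

(** By monotonicity the [s]-th set of an increasing chain triggers a response exactly when the first
    triggering index is at most [s]; hence the first indices alone decide whether the run follows
    [A]. *)
Lemma run_tupleE (A : N.+1.-tuple {set V}) (w : I -> Omega) :
  sorted (fun X Y : {set V} => X \subset Y) A ->
  (run_tuple (fun X i => y i (w i) X) == A) = is_run A (fun i => find (y i (w i)) A).
Proof.
move=> A_sorted; set z := fun X i => _.
have findE s : (s < N)%N -> (fun i => find (y i (w i)) A <= s)%N = z (nth finset.set0 A s).
  move=> sN; apply: funext => i; rewrite find_leq_nth ?size_tuple //.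
  exact: ltnW.
apply/eqP/andP => [runA|[/eqP A0 /forallP As]].
  rewrite -{1}runA nth_run_tuple // eqxx; split=> //; apply/forallP => s.
  rewrite findE // -runA !nth_run_tuple //; exact: ltnW.
apply: val_inj; apply: (@eq_from_nth _ finset.set0) => [|s]; rewrite !size_tuple // ltnS.
elim: s => [|s IHs] sN; rewrite nth_run_tuple //.
have /eqP -> := As (Ordinal sN); rewrite findE //= -IHs ?nth_run_tuple //; exact: ltnW.
Qed.

(** With [h] an indicator, the law of the first index is seen to depend on [p] and [y] only through
    the total mass and the masses triggered by the single sets of [A]. *)
Lemma sum_first_firing (A : N.+1.-tuple {set V}) (i : I) (h : nat -> R) :
  sorted (fun X Y : {set V} => X \subset Y) A ->
  \sum_x p i x * h (find (y i x) A) =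
  h N.+1 * \sum_x p i x + \sum_(0 <= s < N.+1) (h s - h s.+1) *
     \sum_x p i x * (y i x (nth finset.set0 A s))%:R.
Proof.
move=> A_sorted; under [X in _ + X]eq_bigr do rewrite mulr_sumr.
rewrite [X in _ + X]exchange_big /= mulr_sumr -big_split; apply: eq_bigr => x _ /=.
rewrite (@sum_by_parts _ h _ N.+1); last by rewrite -[leqRHS](size_tuple A) find_size.
rewrite mulrDr [X in X + _]mulrC; congr +%R; rewrite mulr_sumr !big_mkord.
apply: eq_bigr => s _; rewrite find_leq_nth ?size_tuple //.
by rewrite [LHS]mulrA [RHS]mulrC.
Qed.

(** Outcomes are grouped by trajectory, then by vector of first indices; on each group the product
    weight factors over [i]. *)
Lemma sum_run (g : {set V} -> R) :
  \sum_(w : {ffun I -> Omega}) (\prod_i p i (w i)) * g (run (fun X i => y i (w i) X) N) =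
  \sum_(A : N.+1.-tuple {set V} | sorted (fun X Y : {set V} => X \subset Y) A)
    g (nth finset.set0 A N) *
    \sum_(f : {ffun I -> 'I_N.+2} | is_run A (fun i => f i))
      \prod_i \sum_x p i x * (find (y i x) A == f i)%:R.
Proof.
rewrite (partition_big (fun w : {ffun I -> Omega} => run_tuple (fun X i => y i (w i) X))
  (fun A : N.+1.-tuple {set V} => sorted (fun X Y : {set V} => X \subset Y) A)) /=; last first.
  by move=> w _; exact: run_tuple_sorted.
apply: eq_bigr => A A_sorted.
rewrite (eq_bigr (fun w : {ffun I -> Omega} =>
    (\prod_i p i (w i)) * g (nth finset.set0 A N)))
  => [|w /eqP <-]; last by rewrite nth_run_tuple.
rewrite -mulr_suml mulrC; congr (_ * _).
under [in LHS]eq_bigl => w do rewrite (run_tupleE w A_sorted).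
(* [inord] loses nothing: [find] is at most [size A], which is [N.+1]. *)
pose tau (w : {ffun I -> Omega}) : {ffun I -> 'I_N.+2} :=
  [ffun i => inord (find (y i (w i)) A)].
have tauE w i : tau w i = find (y i (w i)) A :> nat.
  by rewrite ffunE inordK // ltnS -[leqRHS](size_tuple A) find_size.
have is_runE (w : {ffun I -> Omega}) :
    is_run A (fun i => find (y i (w i)) A) = is_run A (fun i => tau w i).
  by congr is_run; apply: funext => i; rewrite tauE.
rewrite (partition_big tau (fun f => is_run A (fun i => f i))) /=;
  last by move=> w; rewrite is_runE.
(* The expanded product of sums runs over all [w]; if [tau w] differs from [f] at some coordinate,
   the factor there is zero. *)
apply: eq_bigr => f Af; rewrite bigA_distr_bigA big_mkcond; apply: eq_bigr => w _ /=.
rewrite big_split /= is_runE; have [eqf|tauNf] := eqVneq (tau w) f.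
  rewrite andbT [X in _ = _ * X]big1 => [|i _]; last by rewrite -tauE eqf eqxx.
  by rewrite mulr1 eqf Af.
have [i tauNfi] : exists i, tau w i != f i.
  apply/existsP; apply: contraNT tauNf => /existsPn eqf.
  by apply/eqP/ffunP => i; apply/eqP/negPn/eqf.
rewrite andbF [X in _ = _ * X](bigD1 i) //= -tauE.
have /negPf -> : tau w i != f i :> nat by [].
by rewrite mul0r mulr0.
Qed.
End Law.

Lemma sum_run_eq (R : comPzRingType) (I V : finType) (N : nat)
    (c : (I -> bool) -> {set V} -> {set V}) (g : {set V} -> R)
    (Omega Omega' : finType)
    (p : I -> Omega -> R) (p' : I -> Omega' -> R)
    (y : I -> Omega -> {set V} -> bool) (y' : I -> Omega' -> {set V} -> bool) :
  (forall b (X : {set V}), X \subset c b X) ->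
  (forall i x, {homo y i x : X Y / X \subset Y >-> X ==> Y}) ->
  (forall i x, {homo y' i x : X Y / X \subset Y >-> X ==> Y}) ->
  (forall i, \sum_x p i x = \sum_x p' i x) ->
  (forall i X, \sum_x p i x * (y i x X)%:R = \sum_x p' i x * (y' i x X)%:R) ->
  \sum_(w : {ffun I -> Omega}) (\prod_i p i (w i)) * g (run c (fun X i => y i (w i) X) N) =
  \sum_(w : {ffun I -> Omega'}) (\prod_i p' i (w i)) * g (run c (fun X i => y' i (w i) X) N).
Proof.
move=> sub_c y_mono y'_mono eq_total eq_fire.
rewrite (sum_run N sub_c p y_mono) (sum_run N sub_c p' y'_mono).
apply: eq_bigr => A A_sorted; congr (_ * _); apply: eq_bigr => f _.
apply: eq_bigr => i _.
pose h (t : nat) : R := (t == f i)%:R.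
rewrite (sum_first_firing p y_mono i h A_sorted).
rewrite (sum_first_firing p' y'_mono i h A_sorted) eq_total; congr (_ + _).
by apply: eq_bigr => s _; rewrite eq_fire.
Qed.

(** * Activation as a monotone operator on sets of agents *)

Section Dynamics.
Variables (n m : nat) (U : 'I_n -> protocol) (S0 : {set 'I_n}).

Definition gate (b : 'I_n * 'I_m -> bool) (i : 'I_n) : bool :=
  match U i with
  | OR => [exists k, b (i, k)]
  | AND => [forall k, b (i, k)]
  end.

Definition activate (b : 'I_n * 'I_m -> bool) (X : {set 'I_n}) : {set 'I_n} :=
  (S0 :|: X :|: [set i | gate b i])%SET.

(** For monotone [z] this is the least fixed point of activation; it unfolds to [fixset], whose
    theory then applies. *)
Definition spread (z : {set 'I_n} -> 'I_n * 'I_m -> bool) : {set 'I_n} :=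
  run activate z #|'I_n|.

Lemma sub_activate b (X : {set 'I_n}) : X \subset activate b X.
Proof. by apply/fintype.subsetP => i Xi; rewrite !inE Xi orbT. Qed.

Lemma gate_mono (b b' : 'I_n * 'I_m -> bool) i :
  (forall ik, b ik ==> b' ik) -> gate b i -> gate b' i.
Proof.
move=> bb'; rewrite /gate; case: (U i) => [/existsP[k bk]|/forallP b_all].
  by apply/existsP; exists k; exact: (implyP (bb' _)).
by apply/forallP => k; exact: (implyP (bb' _)).
Qed.

Section Monotone.
Variable z : {set 'I_n} -> 'I_n * 'I_m -> bool.
Hypothesis z_mono : forall ik, {homo z^~ ik : X Y / X \subset Y >-> X ==> Y}.

Lemma activate_mono :
  {homo (fun X => activate (z X) X) : X Y / X \subset Y}.
Proof.
move=> X Y XY; rewrite /activate !finset.setUSS //.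
by apply/fintype.subsetP => i; rewrite !inE; apply: gate_mono => ik; exact: z_mono.
Qed.

Lemma spreadK : activate (z (spread z)) (spread z) = spread z.
Proof. exact: fixsetK activate_mono. Qed.

Lemma mem_spread_seed i : i \in S0 -> i \in spread z.
Proof. by move=> Si; rewrite -spreadK !inE Si. Qed.

Lemma mem_spread_gate i : gate (z (spread z)) i -> i \in spread z.
Proof. by move=> gi; rewrite -spreadK !inE gi !orbT. Qed.
End Monotone.

(** Seeds are added at every step whatever their responses, so the models may treat seeds
    differently. *)
Lemma eq_spread (z z' : {set 'I_n} -> 'I_n * 'I_m -> bool) :
  (forall X ik, ik.1 \notin S0 -> z X ik = z' X ik) -> spread z = spread z'.
Proof.
move=> zz'; rewrite /spread /run; elim: #|_| => //= t ->; apply/setP => i.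
rewrite !inE; have [//|/= NSi] := boolP (i \in S0); congr (_ || _); rewrite /gate.
case: (U i); first by apply: eq_existsb => k; exact: zz'.
by apply: eq_forallb => k; exact: zz'.
Qed.

Definition points_into (o : option 'I_n) (X : {set 'I_n}) : bool :=
  if o is Some j then j \in X else false.

Lemma points_into_mono o : {homo points_into o : X Y / X \subset Y >-> X ==> Y}.
Proof.
move=> X Y XY; case: o => //= j.
by apply/implyP; exact: (fintype.subsetP XY).
Qed.

Definition follows_live (l : selection n m) (X : {set 'I_n}) (ik : 'I_n * 'I_m) : bool :=
  points_into (l ik) X.

Lemma follows_live_mono l ik :
  {homo (follows_live l)^~ ik : X Y / X \subset Y >-> X ==> Y}.
Proof. by move=> X Y XY; exact: points_into_mono. Qed.

Lemma in_tree_cat (l : selection n m) i (p q : node n m) :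
  in_tree l i (p ++ q) = in_tree l i p && in_tree l (node_agent i p) q.
Proof. by elim: p i => [//|[k j] p IHp] i /=; rewrite IHp andbA. Qed.

Lemma node_agent_cat i (p q : node n m) :
  node_agent i (p ++ q) = node_agent (node_agent i p) q.
Proof. by rewrite /node_agent map_cat last_cat. Qed.

(** * Reachability and the final set of the live-edge cascade *)

Section Reachability.
Variables (R : realType) (G : multiplex R n m) (l : selection n m).
Hypothesis m_gt0 : (0 < m)%N.
Hypothesis l_live : l \in live_selections G S0.

Let l_mono := follows_live_mono l.
Let active : {set 'I_n} := spread (follows_live l).

Lemma live_edge_ex i k : i \notin S0 -> exists j, l (i, k) = Some j.
Proof.
move: l_live; rewrite inE => /forallP/(_ i)/forallP/(_ k) + /negPf NSi.
by rewrite NSi; case: (l (i, k)) => // j _; exists j.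
Qed.

Lemma reachable_active i : reachable U S0 l i -> i \in active.
Proof.
move=> [Bs [Bs_branch [[B BsB] feas]]].
(* The claim is extended to all nodes of the branches; [d] bounds the depth still available below
   [p]. *)
suff act d p : nodes_of Bs p -> (n <= size p + d)%N -> node_agent i p \in active.
  by apply: (act n [::]) => //; exists B; rewrite ?prefix0s.
elim: d p => [|d IHd] p [B' BsB' /prefixP[s defB']] size_p.
  (* A node at depth [n] or more would lie on a branch with more than [n] distinct agents. *)
  have [_ _ /card_uniqP cardB'] := Bs_branch _ BsB'.
  have := max_card (mem (i :: map snd B')).
  rewrite cardB' card_ord /= size_map defB' size_cat ltnNge => /negP[].
  by rewrite (leq_trans size_p) // addn0 leq_addr.
have [Sp|NSp] := boolP (node_agent i p \in S0); first exact: mem_spread_seed.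
have child k j : nodes_of Bs (rcons p (k, j)) -> j \in active.
  move=> /IHd; rewrite -cats1 node_agent_cat; apply.
  by rewrite size_cat /= addn1 addSnnS.
(* An OR agent is triggered by the next step of the branch through [p], which exists because [p]
   does not end in a seed; an AND agent by all its children, which feasibility provides. *)
apply: mem_spread_gate => //; rewrite /gate; case Up: (U _).
  have [treeB' SB' _] := Bs_branch _ BsB'.
  case: s => [|[k j] s] in defB'.
    by move: SB' NSp; rewrite defB' cats0 => ->.
  move: treeB'; rewrite defB' in_tree_cat /= => /and3P[_ /eqP lk _].
  apply/existsP; exists k; rewrite /follows_live /points_into lk; apply: (child k).
  by exists B' => //; apply/prefixP; exists s; rewrite cat_rcons.
apply/forallP => k; have [j lk] := live_edge_ex k NSp.
rewrite /follows_live /points_into lk; apply: (child k); apply: feas => //.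
by exists B' => //; apply/prefixP; exists s.
Qed.

(** The activation time: on [active], the first iterate from the empty set containing the agent. *)
Let rank := fix_order (fun X => activate (follows_live l X) X).

(* Following live edges along which the activation time decreases keeps a
   branch from visiting an agent twice. *)
Let earlier (i j : 'I_n) : bool := (j \in active) && (rank j < rank i)%N.

(** A nonseed enters because its gate fired on the previous iterate, all of whose members have
    smaller rank. *)
Lemma gate_earlier i : i \in active -> i \notin S0 ->
  gate (fun ik => if l ik is Some j then earlier i j else false) i.
Proof.
move=> act_i NSi; have l_homo := activate_mono l_mono.
move: (act_i); rewrite -(in_iter_fix_orderE _ i) -/rank.
have rank_gt0 : (0 < rank i)%N by rewrite fix_order_gt0.
rewrite -(prednK rank_gt0) iterS !inE (negPf NSi) /= => /orP[/(fix_order_small l_homo)|].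
  by rewrite -/rank -ltnS prednK // ltnn.
apply: gate_mono => ik; rewrite /follows_live /points_into; case: (l ik) => // j.
apply/implyP => act_j; rewrite /earlier (fintype.subsetP (iter_sub_fix l_homo _) _ act_j).
by rewrite -[ltnRHS](prednK rank_gt0) ltnS; exact: fix_order_small.
Qed.

Let decreasing_branch i B :=
  [/\ in_tree l i B, node_agent i B \in S0 & path earlier i (map snd B)].

Lemma decreasing_branch_ex i : i \in active -> exists B, decreasing_branch i B.
Proof.
have [r] := ubnP (rank i); elim: r i => // r IHr i; rewrite ltnS => rank_i act_i.
have [Si|NSi] := boolP (i \in S0); first by exists [::].
have [k [j [lk ij]]] : exists k j, l (i, k) = Some j /\ earlier i j.
  have := gate_earlier act_i NSi; rewrite /gate; case: (U i) => [/existsP[k]|].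
    by case lk: (l (i, k)) => [j|//] ij; exists k, j.
  (* An AND gate over no layers would hold vacuously; [m_gt0] supplies an edge to follow. *)
  move=> /forallP/(_ (Ordinal m_gt0)).
  by case lk: (l _) => [j|//] ij; exists (Ordinal m_gt0), j.
have /andP[act_j lt_ji] := ij.
have [B [treeB SB pathB]] := IHr j (leq_trans lt_ji rank_i) act_j.
by exists ((k, j) :: B); split; rewrite //= ?lk ?eqxx ?ij.
Qed.

Lemma active_reachable i : i \in active -> reachable U S0 l i.
Proof.
move=> act_i; exists [set B | decreasing_branch i B]%classic; split.
  move=> B [treeB SB pathB]; split=> //.
  have earlier_trans : transitive earlier.
    move=> a b c /andP[_ ab] /andP[act_c ca]; rewrite /earlier act_c.
    exact: ltn_trans ca ab.
  apply: (sorted_uniq earlier_trans) => [a|]; last exact: pathB.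
  by rewrite /earlier ltnn andbF.
split; first exact: decreasing_branch_ex.
move=> p [B [treeB SB pathB] /prefixP[s defB]] NSp Up k j lk.
move: treeB pathB; rewrite defB in_tree_cat map_cat cat_path.
move=> /andP[treep _] /andP[pathp _].
have act_p : node_agent i p \in active.
  case: (lastP p) pathp => [//|q [k' a]]; rewrite map_rcons rcons_path /node_agent.
  by rewrite map_rcons last_rcons => /andP[_ /andP[]].
have pj : earlier (node_agent i p) j.
  have := gate_earlier act_p NSp; rewrite /gate Up => /forallP/(_ k).
  by rewrite lk.
have /andP[act_j _] := pj; have [C [treeC SC pathC]] := decreasing_branch_ex act_j.
(* The branch is followed down to [p], then the required edge is taken, then a decreasing branch
   from [j] to a seed. *)
exists (p ++ (k, j) :: C); last by rewrite /= -cat_rcons prefix_prefix.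
split; first by rewrite in_tree_cat treep /= lk eqxx.
  by rewrite node_agent_cat.
by rewrite map_cat cat_path pathp /= pathC andbT.
Qed.

Lemma reachableE i : `[< reachable U S0 l i >] = (i \in spread (follows_live l)).
Proof.
by apply/asboolP/idP => [/reachable_active|/active_reachable].
Qed.
End Reachability.

End Dynamics.

(** * Sums over options, finite-valued random variables and the uniform law *)

Lemma sum_option (V : nmodType) (J : finType) (F : option J -> V) :
  \sum_o F o = F None + \sum_j F (Some j).
Proof.
rewrite (bigD1 None) //=; congr (_ + _).
rewrite (@reindex_omap _ _ _ _ _ Some id) => [|[j|]] //=.
by apply: eq_bigl => j; rewrite eqxx.
Qed.

Section FiniteValued.
Context d (T : measurableType d) (R : realType) (P : probability T R).

Lemma expectation_finite_valued (W : finType) (Y : T -> W) (h : W -> R) :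
  (forall v, measurable (Y @^-1` [set v])%classic) ->
  'E_P[fun w => h (Y w)]%E = (\sum_v fine (P (Y @^-1` [set v])%classic) * h v)%:E.
Proof.
move=> mY; rewrite unlock.
have decomp w : (h (Y w))%:E = (\sum_v (h v)%:E * (\1_(Y @^-1` [set v]) w)%:E)%E.
  rewrite (bigD1 (Y w)) //= big1 => [|v /eqP vY]; last first.
    by rewrite indicE memNset ?mule0 // => /esym.
  by rewrite indicE mem_set // mule1 adde0.
under eq_integral do rewrite decomp.
have mi v := integrable_indic P (mY v).
rewrite integral_sum // => [|v]; last exact: integrableZl.
rewrite -sumEFin; apply: eq_bigr => v _.
by rewrite integralZl // integral_indic // setIT EFinM muleC fineK // fin_num_measure.
Qed.

Lemma prob_lt_uniform (X : {RV P >-> R}) (x : R) :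
  (forall A : set R, measurable A -> distribution P X A = uniform_prob (@ltr01 R) A) ->
  0 <= x <= 1 -> P (X @^-1` [set r | r < x])%classic = x%:E.
Proof.
move=> unifX /andP[x0 x1].
rewrite -set_itvNyo.
have -> : P (X @^-1` `]-oo, x[)%classic =
    distribution P X `]-oo, x[%classic by [].
rewrite unifX //= /uniform_prob integral_uniform_pdf.
have -> : (`]-oo, x[ `&` `[0%R, 1%R] = `[0%R, x[)%classic.
  apply/seteqP; split=> r; rewrite /= !in_itv /=.
    by move=> [-> /andP[->]].
  by move=> /andP[-> rx]; rewrite rx (le_trans (ltW rx)).
rewrite (eq_integral (fun=> 1%:E)) => [|r]; last first.
  rewrite inE /= in_itv /= /uniform_pdf => /andP[-> rx].
  by rewrite (le_trans (ltW rx)) //= subr0 invr1.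
rewrite integral_cst //= mul1e lebesgue_measure_itv /= lte_fin oppr0 adde0.
(* The interval formula distinguishes the empty case, where [x] is zero. *)
by case: ltP => // x_le0; congr (_%:E); apply/eqP; rewrite eq_le x0.
Qed.
End FiniteValued.

(** * The live-edge and threshold models as cascades *)

Section Model.
Variables (R : realType) (n m : nat) (G : multiplex R n m) (S0 : {set 'I_n}).
Hypothesis G_out : nonseeds_have_out_neighbors G S0.

(** The value zero at seeds matches their blocked edges in the live-edge model. *)
Definition sensed_weight (ik : 'I_n * 'I_m) (X : {set 'I_n}) : R :=
  if ik.1 \in S0 then 0
  else \sum_(j in (out_neighbors G ik.2 ik.1 :&: X)%SET) weight G ik.2 ik.1 j.

(** The law of the live edge of one pair, extended by zero to non-edges, so that sums over
    selections range over a full product space. *)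
Definition live_mass (ik : 'I_n * 'I_m) (o : option 'I_n) : R :=
  if ik.1 \in S0 then (o == None)%:R
  else if o is Some j then (edge G ik.2 ik.1 j)%:R * weight G ik.2 ik.1 j else 0.

Lemma sum_live_mass ik : \sum_o live_mass ik o = 1.
Proof.
rewrite sum_option /live_mass; have [|NSi] := boolP (ik.1 \in S0).
  by rewrite eqxx big1 ?addr0.
have [j] := G_out ik.2 NSi; rewrite inE => ij.
rewrite add0r -[RHS](weight_sum1 (ex_intro _ j ij)) [RHS]big_mkcond.
by apply: eq_bigr => j1 _; case: (edge _ _ _ _); rewrite ?mul1r ?mul0r.
Qed.

Lemma sum_live_mass_in ik (X : {set 'I_n}) :
  \sum_o live_mass ik o * (points_into o X)%:R =
  sensed_weight ik X.
Proof.
rewrite sum_option /points_into mulr0 add0r /live_mass /sensed_weight; case: ifP => _.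
  by rewrite big1 // => j _; rewrite mul0r.
rewrite [RHS]big_mkcond; apply: eq_bigr => j _; rewrite !inE.
by case: (edge _ _ _ _); case: (j \in X); rewrite ?mul1r ?mulr1 ?mul0r ?mulr0.
Qed.

Lemma sensed_weight_mono ik (X Y : {set 'I_n}) :
  X \subset Y -> sensed_weight ik X <= sensed_weight ik Y.
Proof.
move=> XY; rewrite /sensed_weight; case: ifP => // _.
rewrite big_mkcond [leRHS]big_mkcond; apply: ler_sum => j _; rewrite !inE.
case: ifPn => [/andP[ij /(fintype.subsetP XY) ->]|_]; first by rewrite ij.
by case: ifP => // /andP[/weight_gt0/ltW].
Qed.

Lemma sensed_weight_itv ik (X : {set 'I_n}) : 0 <= sensed_weight ik X <= 1.
Proof.
have sw0 : sensed_weight ik finset.set0 = 0.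
  by rewrite /sensed_weight finset.setI0 big_set0 if_same.
rewrite -{1}sw0 sensed_weight_mono ?finset.sub0set //=.
apply: le_trans (sensed_weight_mono ik (finset.subsetT X)) _.
rewrite /sensed_weight; have [//|NSi] := boolP (ik.1 \in S0).
have [j] := G_out ik.2 NSi; rewrite inE => ij.
rewrite -[leRHS](weight_sum1 (ex_intro _ j ij)) finset.setIT le_eqVlt; apply/orP; left.
by apply/eqP; apply: eq_bigl => j'; rewrite inE.
Qed.

Lemma prod_live_mass (l : selection n m) :
  \prod_ik live_mass ik (l ik) =
  if l \in live_selections G S0 then selection_prob G l else 0.
Proof.
case: ifPn => [|l_dead].
  rewrite inE => /forallP l_live; apply: eq_bigr => -[i k] _ /=.
  have /forallP/(_ k) := l_live i; rewrite /live_mass /=; case: ifP => _.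
    by move=> /eqP ->; rewrite eqxx.
  by case: (l (i, k)) => // j ->; rewrite mul1r.
have /existsP[i /existsP[k dead]] : [exists i, exists k, ~~
    (if i \in S0 then l (i, k) == None
     else if l (i, k) is Some j then edge G k i j else false)].
  apply: contraNT l_dead => /existsPn live; rewrite inE; apply/forallP => i.
  by apply/forallP => k; have /existsPn/(_ k)/negPn := live i.
rewrite (bigD1 (i, k)) //= [X in X * _](_ : _ = 0) ?mul0r // /live_mass /=.
move: dead; case: ifP => _; first by move=> /negPf ->.
by case: (l (i, k)) => // j /negPf ->; rewrite mul0r.
Qed.

Variable U : 'I_n -> protocol.

Lemma sum_reach_prob : (0 < m)%N ->
  \sum_(i < n) reach_prob G U S0 i =
  \sum_(l : selection n m) (\prod_ik live_mass ik (l ik)) *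
    \sum_(i < n) (i \in spread U S0 (follows_live l))%:R.
Proof.
move=> m_gt0; under [RHS]eq_bigr do rewrite mulr_sumr.
rewrite exchange_big; apply: eq_bigr => i _; rewrite /reach_prob; case: ifPn => [Si|NSi].
  (* A seed lies in every final set, so its sum is the total mass, a product of ones. *)
  under eq_bigr => l do rewrite (mem_spread_seed U (follows_live_mono l)) // mulr1.
  rewrite -(bigA_distr_bigA live_mass) big1 // => ik _; exact: sum_live_mass.
rewrite [LHS]big_mkcond; apply: eq_bigr => l _; rewrite prod_live_mass.
have [l_live|_] := boolP (l \in live_selections G S0); last by rewrite mul0r.
by rewrite /= (reachableE U m_gt0 l_live); case: ifP; rewrite ?mulr1 ?mulr0.
Qed.

Lemma layer_input_mono (mu : 'I_n -> 'I_m -> R) ik :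
  {homo (fun X => layer_input G mu X ik.1 ik.2) : X Y / X \subset Y >-> X ==> Y}.
Proof.
move=> X Y XY; apply/implyP => /lt_le_trans; apply.
rewrite big_mkcond [leRHS]big_mkcond; apply: ler_sum => j _; rewrite !inE.
case: ifPn => [/andP[ij /(fintype.subsetP XY) ->]|_]; first by rewrite ij.
by case: ifP => // /andP[/weight_gt0/ltW].
Qed.

(** The threshold process starts from the seeds, [run] from the empty set. The process is squeezed
    between [run] at the same time and the fixed point, which [run] reaches within [n] steps. *)
Lemma ltm_steadyE (mu : 'I_n -> 'I_m -> R) i :
  ltm_steady G U S0 mu i =
  (i \in spread U S0 (fun X ik => layer_input G mu X ik.1 ik.2))%:R.
Proof.
set z := fun X ik => _; set act := spread U S0 z.
have z_mono ik : {homo z^~ ik : X Y / X \subset Y >-> X ==> Y} := @layer_input_mono mu ik.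
pose S t : {set 'I_n} := [set j | ltm_state G U S0 mu t j]%SET.
have S_S t : S t.+1 = (S t :|: [set j | gate U (z (S t)) j])%SET.
  by apply/setP => j; rewrite !inE.
have seed_S t : S0 \subset S t.
  elim: t => [|t IHt]; first by apply/fintype.subsetP => j; rewrite inE.
  by rewrite S_S (fintype.subset_trans IHt) // finset.subsetUl.
have activate_S t : activate U S0 (z (S t)) (S t) = S t.+1.
  by rewrite S_S /activate (finset.setUidPr (seed_S t)).
have S_act t : S t \subset act.
  elim: t => [|t IHt].
    by apply/fintype.subsetP => j; rewrite inE; exact: mem_spread_seed.
  by rewrite -activate_S -[act](spreadK U S0 z_mono); exact: activate_mono.
have run_S t : run (activate U S0) z t \subset S t.
  elim: t => [|t IHt]; first exact: finset.sub0set.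
  by rewrite -activate_S; exact: (activate_mono U S0 z_mono IHt).
rewrite /ltm_steady; apply: lim_near_cst; first exact: Rhausdorff.
near=> t; congr (_%:R).
have -> : ltm_state G U S0 mu t i = (i \in S t) by rewrite inE.
suff -> : S t = act by [].
apply/eqP; rewrite finset.eqEsubset S_act; apply: fintype.subset_trans (run_S t).
apply: (subset_iter (activate_mono U S0 z_mono)).
near: t; exact: nbhs_infty_ge.
Unshelve. all: by end_near. Qed.

(** A threshold matters only through the sets that exceed it; this replaces a real number by an
    element of a finite type. *)
Definition fired_sets (ik : 'I_n * 'I_m) (r : R) : {set {set 'I_n}} :=
  [set X | r < sensed_weight ik X]%SET.

(** The upward closure makes the response monotone for every [v], including those that no threshold
    produces. *)
Definition fires (v : {set {set 'I_n}}) (X : {set 'I_n}) : bool :=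
  [exists Y : {set 'I_n}, (Y \subset X) && (Y \in v)].

Lemma fires_mono v : {homo fires v : X Y / X \subset Y >-> X ==> Y}.
Proof.
move=> X Y XY; apply/implyP => /existsP[Z /andP[ZX vZ]].
by apply/existsP; exists Z; rewrite (fintype.subset_trans ZX).
Qed.

Lemma fires_fired_sets ik r X : fires (fired_sets ik r) X = (r < sensed_weight ik X).
Proof.
apply/existsP/idP => [[Y]|rX]; last by exists X; rewrite inE rX fintype.subxx.
by rewrite inE => /andP[YX /lt_le_trans]; apply; exact: sensed_weight_mono.
Qed.

Lemma measurable_fired_sets ik v : measurable [set r : R | fired_sets ik r = v]%classic.
Proof.
have -> : [set r | fired_sets ik r = v]%classic =
    (\bigcap_X (if X \in v then `]-oo, sensed_weight ik X[
       else `[sensed_weight ik X, +oo[))%classic.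
  apply/seteqP; split=> r /=.
    by move=> <- X _; rewrite inE; case: ltP => rX; rewrite /= in_itv /= ?rX.
  move=> r_in; apply/setP => X; have := r_in X I; rewrite inE.
  by case: ifP => _ /=; rewrite in_itv /= ?andbT ?leNgt => // /negPf.
by apply: fin_bigcap_measurable => // X _; case: ifP.
Qed.

Context d (T : measurableType d) (P : probability T R).
Variable mu : 'I_n -> 'I_m -> {RV P >-> R}.
Hypothesis mu_unif : iid_uniform mu.

Definition fired_mass (ik : 'I_n * 'I_m) (v : {set {set 'I_n}}) : R :=
  fine (P (mu ik.1 ik.2 @^-1` [set r | fired_sets ik r = v])%classic).

Lemma measurable_mu_fired_sets ik v :
  measurable (mu ik.1 ik.2 @^-1` [set r | fired_sets ik r = v])%classic.
Proof.
rewrite -[X in measurable X]setTI; apply: measurable_funP => //.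
exact: measurable_fired_sets.
Qed.

Lemma expectation_fired_sets ik (h : {set {set 'I_n}} -> R) :
  'E_P[fun w => h (fired_sets ik (mu ik.1 ik.2 w))]%E =
  (\sum_v fired_mass ik v * h v)%:E.
Proof. exact: expectation_finite_valued (measurable_mu_fired_sets ik). Qed.

Lemma sum_fired_mass ik : \sum_v fired_mass ik v = 1.
Proof.
apply: EFin_inj; have := expectation_fired_sets ik (fun=> 1).
by rewrite expectation_cst; under eq_bigr do rewrite mulr1.
Qed.

(** Here uniformity enters: a threshold lies below a number of the unit interval with that
    probability. *)
Lemma sum_fired_mass_fires ik (X : {set 'I_n}) :
  \sum_v fired_mass ik v * (fires v X)%:R = sensed_weight ik X.
Proof.
apply: EFin_inj; rewrite -(expectation_fired_sets ik (fun v => (fires v X)%:R)).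
rewrite -(prob_lt_uniform (mu_unif.1 ik.1 ik.2) (sensed_weight_itv ik X)).
rewrite -expectation_indic; last first.
  rewrite -[X in measurable X]setTI; apply: measurable_funP => //.
  by rewrite -set_itvNyo.
congr expectation; apply: funext => w; rewrite fires_fired_sets indicE.
case: ltP => [wX|Xw]; first by rewrite mem_set.
by rewrite memNset //= ltNge Xw.
Qed.

(** Here independence enters: a fiber of the joint response is an intersection of events on single
    thresholds. *)
Lemma expectation_all_fired_sets (h : {ffun 'I_n * 'I_m -> {set {set 'I_n}}} -> R) :
  'E_P[fun w => h [ffun ik => fired_sets ik (mu ik.1 ik.2 w)]]%E =
  (\sum_(f : {ffun _ -> {set {set 'I_n}}}) (\prod_ik fired_mass ik (f ik)) * h f)%:E.
Proof.
have fiberE (f : {ffun 'I_n * 'I_m -> {set {set 'I_n}}}) :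
    ((fun w => [ffun ik => fired_sets ik (mu ik.1 ik.2 w)]) @^-1` [set f] =
     \bigcap_(ik in [set ik | ik \in [set: 'I_n * 'I_m]%SET])
       (mu ik.1 ik.2 @^-1` [set r | fired_sets ik r = f ik]))%classic.
  apply/seteqP; split=> w /=; first by move=> <- ik _; rewrite /= ffunE.
  by move=> wf; apply/ffunP => ik; rewrite ffunE; apply: wf; rewrite /= inE.
rewrite (expectation_finite_valued P h) => [|f]; last first.
  rewrite fiberE; apply: fin_bigcap_measurable => // ik _.
  exact: measurable_mu_fired_sets.
congr (_%:E); apply: eq_bigr => f _; congr (_ * _); rewrite fiberE.
rewrite (mu_unif.2 [set: 'I_n * 'I_m]%SET (fun ik => [set r | fired_sets ik r = f ik]%classic)).
  rewrite (eq_bigr (fun ik => (fired_mass ik (f ik))%:E)) => [|ik _].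
    by rewrite prodEFin; apply: eq_bigl => ik; rewrite inE.
  by rewrite fineK // fin_num_measure //; exact: measurable_mu_fired_sets.
by move=> ik; exact: measurable_fired_sets.
Qed.

Lemma influence_spreadE : (0 < m)%N ->
  influence_spread mu G U S0 = (\sum_(i < n) reach_prob G U S0 i)%:E.
Proof.
move=> m_gt0; rewrite sum_reach_prob //.
pose g (X : {set 'I_n}) : R := \sum_(i < n) (i \in X)%:R.
have <- := sum_run_eq #|'I_n| g (@sub_activate n m U S0) (fun=> fires_mono)
  (fun=> @points_into_mono n)
  (fun ik => etrans (sum_fired_mass ik) (esym (sum_live_mass ik)))
  (fun ik X => etrans (sum_fired_mass_fires ik X) (esym (sum_live_mass_in ik X))).
rewrite -(expectation_all_fired_sets (fun f => g (spread U S0 (fun X ik => fires (f ik) X)))).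
congr expectation; apply: funext => w; apply: eq_bigr => i _; rewrite ltm_steadyE.
(* At seeds [sensed_weight] is zero and may disagree with [layer_input], which does not affect the
   spread. *)
rewrite (eq_spread U (z' := fun X ik =>
  fires ([ffun ik => fired_sets ik (mu ik.1 ik.2 w)] ik) X)) // => X ik /negPf NSi.
by rewrite ffunE fires_fired_sets /sensed_weight NSi.
Qed.
End Model.

Theorem corollary1 (R : realType) (n m : nat) (hm : (0 < m)%N)
    (G : multiplex R n m) (U : 'I_n -> protocol)
    (d : measure_display) (T : measurableType d) (P : probability T R)
    (mu : 'I_n -> 'I_m -> {RV P >-> R}) (hmu : iid_uniform mu)
    (S0 : {set 'I_n}) (j : 'I_n) :
  (nonseeds_have_out_neighbors G S0 ->
     influence_spread mu G U S0 = (\sum_(i < n) reach_prob G U S0 i)%:E) /\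
  (nonseeds_have_out_neighbors G [set j]%SET ->
     cascade_centrality mu G U j =
       (\sum_(i < n) reach_prob G U [set j]%SET i)%:E).
Proof.
by split=> G_out; exact: influence_spreadE.
Qed.
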